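(* Let $T_1,\dots,T_N:\mathbb{R}^n\rightrightarrows\mathbb{R}^n$ satisfy Assumption 1 and let $W,\tilde W\in\mathbb{R}^{N\times N}$ satisfy Assumption 2 (both stated in the context). Let $\alpha>0$ be arbitrary, and let $\{z_i^k\}_{k\ge0}$ and $\{v_i^k\}_{k\ge1}$, $i=1,\dots,N$, be any sequences generated by the inexact Proximal-Correction Algorithm (defined in the context) under criterion (A1) (or under criterion (A2)), i.e. such that for some nonnegative sequence with $\sum_{k=0}^\infty\varepsilon_{k+1}<\infty$ one has, for all $k\ge0$, $$\text{(A1)}\quad \big\|Z^{k+2}-\mathrm{prox}_{\alpha T}(\widehat Z^{k+1})\big\|\le\varepsilon_{k+1},\qquad\text{or}\qquad \text{(A2)}\quad \mathrm{dist}\big(\mathbf 0,S_T^{k+1}(Z^{k+2})\big)\le\varepsilon_{k+1}/\alpha .$$ Then the sequences $\{z_i^k\}_{k\ge0}$, $i=1,\dots,N$, all converge to the same point $z^\infty$, which is a solution of $\mathbf 0\in\sum_{i=1}^N T_i(z)$; and for each $i=1,\dots,N$ the sequence $\{v_i^k\}$ converges to an element of $T_i(z^\infty)$.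
   Context: Problem: $\mathcal G=(\mathcal V,\mathcal E)$ is a connected undirected graph with vertex set $\mathcal V=\{1,\dots,N\}$. The problem is to find $z\in\mathbb{R}^n$ with $\mathbf 0\in\sum_{i=1}^N T_i(z)$, where $T_i:\mathbb{R}^n\rightrightarrows\mathbb{R}^n$. Notation: $D(T)=\{x:T(x)\ne\emptyset\}$; $\mathbf 1$ is the all-ones vector; $A\succ 0$ ($A\succcurlyeq 0$) means $A$ is symmetric positive definite (semidefinite), and $B\succcurlyeq A$ means $B-A\succcurlyeq 0$. $\mathbb{R}^{N\times n}$ carries the Euclidean (Frobenius) inner product and norm. Assumption 1: (a) each $T_i$ is maximal monotone; (b) $\left(\bigcap_{i=1}^{N-1}D(T_i)\right)\cap\mathrm{int}(D(T_N))\ne\emptyset$; (c) the problem $\mathbf 0\in\sum_{i=1}^N T_i(z)$ has at least one solution. Assumption 2: $W=[w_{ij}]$ and $\tilde W=[\tilde w_{ij}]$ in $\mathbb{R}^{N\times N}$ satisfy: (a) if $i\neq j$ and $(i,j)\notin\mathcal E$ then $w_{ij}=\tilde w_{ij}=0$; (b) $W\mathbf 1=\mathbf 1$, $\mathbf 1^\top W=\mathbf 1^\top$, $\tilde W\mathbf 1=\mathbf 1$, $\mathbf 1^\top\tilde W=\mathbf 1^\top$; (c) $\mathrm{null}\{\tilde W-W\}=\mathrm{span}\{\mathbf 1\}$ and $\mathrm{null}\{I-\tilde W\}\supseteq\mathrm{span}\{\mathbf 1\}$; (d) $\tilde W\succ 0$ and $(I+W)/2\succcurlyeq\tilde W\succcurlyeq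 W$. Collective operator: for $Z\in\mathbb{R}^{N\times n}$ with rows $z_1^\top,\dots,z_N^\top$, $T(Z)$ is the set of all $V\in\mathbb{R}^{N\times n}$ with rows $v_i^\top$, $v_i\in T_i(z_i)$. $\mathrm{prox}_{\alpha T}=(I+\alpha T)^{-1}$, single-valued and everywhere defined. Inexact Proximal-Correction Algorithm: choose any $Z^0\in\mathbb{R}^{N\times n}$; $Z^1\in\mathbb{R}^{N\times n}$ is an approximation of $\mathrm{prox}_{\alpha T}(WZ^0)$ (the criteria impose no quantitative condition on this first step), and $V^1=(WZ^0-Z^1)/\alpha$. For $k=0,1,2,\dots$ put $$\widehat Z^{k+1}=(I+W)Z^{k+1}-\tilde WZ^k+\alpha V^{k+1},$$ let $Z^{k+2}$ be an approximation of $\mathrm{prox}_{\alpha T}(\widehat Z^{k+1})$ satisfying the chosen criterion, and set $V^{k+2}=(\widehat Z^{k+1}-Z^{k+2})/\alpha$. The rows of $Z^k$ and $V^k$ are $(z_i^k)^\top$ and $(v_i^k)^\top$. In criterion (A2), $$S_T^{k+1}(Z)=T(Z)+\big(Z-\widehat Z^{k+1}\big)/\alpha ,$$ and $\mathrm{dist}(\mathbf 0,\cdot)$ is the distance from $\mathbf 0$ to a set ($+\infty$ for the empty set). *)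

(* Defs.v *)
From mathcomp Require Import all_boot all_order all_algebra.
From mathcomp Require Import all_classical all_reals all_analysis.
Set Implicit Arguments.
Unset Strict Implicit.
Unset Printing Implicit Defensive.
Import Order.TTheory GRing.Theory Num.Theory.
Import numFieldNormedType.Exports.
Local Open Scope classical_set_scope.
Local Open Scope ring_scope.

(* Points of R^n are row vectors, so that z_i is literally [row i Z].  There
   are N.+1 agents, indexed by 'I_N.+1; the distinguished last agent is
   ord_max. *)

(* The library norm on 'M[R]_(m, n) is the sup norm; the Frobenius one
   (Euclidean for m = 1) is needed here. *)
Definition frob_dot (R : realType) (m n : nat) (A B : 'M[R]_(m, n)) : R :=
  \tr (A *m B^T).

Definition frob_norm (R : realType) (m n : nat) (A : 'M[R]_(m, n)) : R :=
  Num.sqrt (frob_dot A A).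

(* As ereal_inf set0 = +oo, the distance to the empty set is +oo. *)
Definition frob_dist (R : realType) (m n : nat) (A : 'M[R]_(m, n))
    (S : set 'M[R]_(m, n)) : \bar R :=
  ereal_inf [set (frob_norm (A - B))%:E | B in S].

(** Set-valued operators *)

Definition op_dom (U : Type) (T : U -> set U) : set U := [set x | T x !=set0].

Definition monotone_op (R : realType) (n : nat)
    (T : 'rV[R]_n -> set 'rV[R]_n) : Prop :=
  forall x y u v, T x u -> T y v -> 0 <= frob_dot (x - y) (u - v).

Definition maximal_monotone (R : realType) (n : nat)
    (T : 'rV[R]_n -> set 'rV[R]_n) : Prop :=
  monotone_op T /\
  forall T' : 'rV[R]_n -> set 'rV[R]_n,
    monotone_op T' -> (forall x, T x `<=` T' x) -> forall x, T' x = T x.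

Definition sum_op (R : realType) (n N : nat)
    (T : 'I_N.+1 -> 'rV[R]_n -> set 'rV[R]_n) (z : 'rV[R]_n) : set 'rV[R]_n :=
  [set \sum_i u i | u in [set u : 'I_N.+1 -> 'rV[R]_n | forall i, T i z (u i)]].

Definition collective_op (R : realType) (n N : nat)
    (T : 'I_N.+1 -> 'rV[R]_n -> set 'rV[R]_n) (Z : 'M[R]_(N.+1, n)) :
    set 'M[R]_(N.+1, n) :=
  [set V | forall i, T i (row i Z) (row i V)].

Definition resolvent (R : realType) (U : lmodType R) (alpha : R)
    (T : U -> set U) (y : U) : set U :=
  [set x | exists2 v, T x v & y = x + alpha *: v].

(* The element of the resolvent set, which is a singleton for every y when
   alpha > 0 and T is (a product of) maximal monotone operators; the default
   value 0 is then never used. *)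
Definition prox (R : realType) (U : lmodType R) (alpha : R)
    (T : U -> set U) (y : U) : U :=
  xget 0 (resolvent alpha T y).

Definition assumption1 (R : realType) (n N : nat)
    (T : 'I_N.+1 -> 'rV[R]_n -> set 'rV[R]_n) : Prop :=
  [/\ forall i, maximal_monotone (T i),
      (\bigcap_(i in [set i | i != ord_max]) op_dom (T i))
        `&` interior (op_dom (T ord_max)) !=set0
    & exists z, sum_op T z 0].

(** Graph and mixing matrices *)

(* Loops are irrelevant here: only pairs of distinct vertices are ever
   tested for adjacency. *)
Definition connected_undirected (V : finType) (e : rel V) : Prop :=
  symmetric e /\ forall i j, connect e i j.

Definition posdef (R : realType) (N : nat) (A : 'M[R]_N) : Prop :=
  A^T = A /\ forall x : 'cV[R]_N, x != 0 -> 0 < (x^T *m A *m x) 0 0.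

Definition possemidef (R : realType) (N : nat) (A : 'M[R]_N) : Prop :=
  A^T = A /\ forall x : 'cV[R]_N, 0 <= (x^T *m A *m x) 0 0.

Definition ones (R : realType) (N : nat) : 'cV[R]_N := const_mx 1.
Arguments ones {R N}.

Definition nullsp (R : realType) (N : nat) (A : 'M[R]_N) : set 'cV[R]_N :=
  [set x | A *m x = 0].

Definition span_ones (R : realType) (N : nat) : set 'cV[R]_N :=
  [set c *: ones | c in [set: R]].
Arguments span_ones {R N}.

Record assumption2 (R : realType) (N : nat) (e : rel 'I_N.+1)
    (W Wt : 'M[R]_N.+1) : Prop := Assumption2 {
  mix_sparse : forall i j, i != j -> ~~ e i j -> W i j = 0 /\ Wt i j = 0;
  mix_stochastic : [/\ W *m ones = ones, ones^T *m W = ones^T,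
                       Wt *m ones = ones & ones^T *m Wt = ones^T];
  mix_null_diff : nullsp (Wt - W) = span_ones;
  mix_null_id : span_ones `<=` nullsp (1%:M - Wt);
  mix_posdef : posdef Wt;
  mix_upper : possemidef (2^-1 *: (1%:M + W) - Wt);
  mix_lower : possemidef (Wt - W) }.

(** The algorithm *)

(* [Zhat W Wt alpha Z V k] is \hat Z^{k+1}. *)
Definition Zhat (R : realType) (n N : nat) (W Wt : 'M[R]_N.+1) (alpha : R)
    (Z V : nat -> 'M[R]_(N.+1, n)) (k : nat) : 'M[R]_(N.+1, n) :=
  (1%:M + W) *m Z k.+1 - Wt *m Z k + alpha *: V k.+1.

(* Z 0 and Z 1 are unconstrained; V 0 is not part of the algorithm. *)
Definition correction_updates (R : realType) (n N : nat) (W Wt : 'M[R]_N.+1)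
    (alpha : R) (Z V : nat -> 'M[R]_(N.+1, n)) : Prop :=
  V 1%N = alpha^-1 *: (W *m Z 0%N - Z 1%N) /\
  forall k, V k.+2 = alpha^-1 *: (Zhat W Wt alpha Z V k - Z k.+2).

Definition criterionA1 (R : realType) (n N : nat)
    (T : 'I_N.+1 -> 'rV[R]_n -> set 'rV[R]_n) (W Wt : 'M[R]_N.+1) (alpha : R)
    (eps : nat -> R) (Z V : nat -> 'M[R]_(N.+1, n)) : Prop :=
  forall k, frob_norm
    (Z k.+2 - prox alpha (collective_op T) (Zhat W Wt alpha Z V k)) <= eps k.+1.

(* [S_op alpha T Zh] is S_T^{k+1} for Zh = \hat Z^{k+1}. *)
Definition S_op (R : realType) (U : lmodType R) (alpha : R)
    (T : U -> set U) (Zh : U) (Z : U) : set U :=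
  [set V + alpha^-1 *: (Z - Zh) | V in T Z].

Definition criterionA2 (R : realType) (n N : nat)
    (T : 'I_N.+1 -> 'rV[R]_n -> set 'rV[R]_n) (W Wt : 'M[R]_N.+1) (alpha : R)
    (eps : nat -> R) (Z V : nat -> 'M[R]_(N.+1, n)) : Prop :=
  forall k, (frob_dist 0
    (S_op alpha (collective_op T) (Zhat W Wt alpha Z V k) (Z k.+2))
      <= (eps k.+1 / alpha)%:E)%E.

(* Main.v *)
Require Import Defs.
From mathcomp Require Import all_boot all_order all_algebra.
From mathcomp Require Import all_classical all_reals all_analysis.
From mathcomp Require Import ring lra.
Set Implicit Arguments.
Unset Strict Implicit.
Unset Printing Implicit Defensive.
Import Order.TTheory GRing.Theory Num.Theory.
Import numFieldNormedType.Exports.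
Local Open Scope classical_set_scope.
Local Open Scope ring_scope.

(* Write [M = Wt - W], [H = (I + W)/2 - Wt] and [S^k = Z^0 + ... + Z^k]. The
   recursion telescopes to [Zhat^{k+1} = Wt Z^{k+1} - M S^{k+1}], so the exact
   step [(Z, S) |-> (p, S + p)] with [p = prox (Wt Z - M S)] is a preconditioned
   proximal point step for the seminorm [|Z|_Wt^2 + |S|_M^2]. Its fixed points
   are the pairs [(Zs, Ss)] with [Zs] consensual and [- M Ss / alpha] in
   [T Zs]; monotonicity makes the step firmly nonexpansive towards them, and
   summable errors keep the iterates quasi-Fejer monotone. Hence the distance to
   each fixed point converges and the increments vanish; a cluster point of
   [(Z^k, M S^k)] is a fixed point because the graph of [T] is closed, and the
   distance to it tends to 0. As [null M = span 1], [range M] is the orthogonal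
   complement of [1], which ties [M Ss] to dual variables summing to 0.

   That the proximal step is defined everywhere is Minty's theorem; criterion
   (A2) reduces to (A1) by nonexpansiveness of the resolvent. *)

(** * Semi-inner products and Cauchy-Schwarz *)

Record semi_inner (R : realType) (E : lmodType R) (q : E -> E -> R) : Prop :=
  SemiInner {
    siC : forall x y, q x y = q y x;
    siDl : forall x y z, q (x + y) z = q x z + q y z;
    siZl : forall a x y, q (a *: x) y = a * q x y;
    si_ge0 : forall x, 0 <= q x x }.

Definition seminorm (R : realType) (E : lmodType R) (q : E -> E -> R) (x : E)
  : R := Num.sqrt (q x x).

Section SemiInnerTheory.
Variables (R : realType) (E : lmodType R) (q : E -> E -> R).
Hypothesis hq : semi_inner q.

Lemma siDr x y z : q x (y + z) = q x y + q x z.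
Proof. by rewrite siC // siDl // !(siC hq x). Qed.

Lemma siZr a x y : q x (a *: y) = a * q x y.
Proof. by rewrite siC // siZl // (siC hq x). Qed.

Lemma siNl x y : q (- x) y = - q x y.
Proof. by rewrite -scaleN1r siZl // mulN1r. Qed.

Lemma siNr x y : q x (- y) = - q x y.
Proof. by rewrite siC // siNl (siC hq x). Qed.

Lemma si_CauchySchwarz x y : q x y ^+ 2 <= q x x * q y y.
Proof.
have hx := si_ge0 hq x; have hy := si_ge0 hq y.
have key t : 0 <= q x x + 2 * t * q x y + t ^+ 2 * q y y.
  have := si_ge0 hq (x + t *: y).
  rewrite !(siDl hq, siDr, siZl hq, siZr) (siC hq y x) => h.
  apply: le_trans h _; rewrite le_eqVlt; apply/orP; left; apply/eqP; ring.
have [y0|y0] := eqVneq (q y y) 0.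
  have := key (- (q x x + 1) / 2 * q x y); have := key (- (q x y)).
  have [-> _ _|xy0] := eqVneq (q x y) 0; first by rewrite expr0n y0 mulr0.
  (* With [q y y = 0] the polynomial in [key] is affine in [t]; this [t] gives it the value -1. *)
  have := key (- (q x x + 1) / (2 * q x y)).
  rewrite y0 !mulr0 addr0.
  have -> : 2 * (- (q x x + 1) / (2 * q x y)) * q x y = - (q x x + 1) by field.
  by move=> h; exfalso; lra.
have yp : 0 < q y y by rewrite lt_neqAle eq_sym y0.
(* The minimiser of the quadratic in [key]. *)
have := key (- q x y / q y y).
have -> : q x x + 2 * (- q x y / q y y) * q x y + (- q x y / q y y) ^+ 2 * q y y
   = (q x x * q y y - q x y ^+ 2) / q y y by field.
by rewrite pmulr_lge0 ?invr_gt0 // subr_ge0.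
Qed.

Local Notation nrm := (seminorm q).

Lemma seminorm_ge0 x : 0 <= nrm x. Proof. exact: sqrtr_ge0. Qed.

Lemma sqr_seminorm x : nrm x ^+ 2 = q x x.
Proof. by rewrite sqr_sqrtr // si_ge0. Qed.

Lemma ler_dot_seminorm x y : q x y <= nrm x * nrm y.
Proof.
rewrite -sqrtrM ?si_ge0 //; apply: le_trans (ler_norm _) _.
by rewrite -sqrtr_sqr ler_wsqrtr // si_CauchySchwarz.
Qed.

Lemma ler_seminormD x y : nrm (x + y) <= nrm x + nrm y.
Proof.
have h := ler_dot_seminorm x y; have hx := sqr_seminorm x.
have hy := sqr_seminorm y; have x0 := seminorm_ge0 x; have y0 := seminorm_ge0 y.
rewrite -(@ler_pXn2r _ 2) ?nnegrE ?addr_ge0 ?seminorm_ge0 //.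
rewrite sqr_seminorm !(siDl hq, siDr) (siC hq y x) sqrrD -hx -hy; lra.
Qed.

Lemma seminormN x : nrm (- x) = nrm x.
Proof. by rewrite /seminorm siNl siNr opprK. Qed.

End SemiInnerTheory.

(** * The Frobenius inner product and its weighted forms *)

Lemma frob_dotE (R : realType) (m n : nat) (A B : 'M[R]_(m, n)) : frob_dot A B = \sum_i \sum_j A i j * B i j.
Proof.
rewrite /frob_dot /mxtrace; apply: eq_bigr => i _; rewrite mxE.
by apply: eq_bigr => j _; rewrite mxE.
Qed.

Section Frobenius.
Variables (R : realType) (m n : nat).
Implicit Types (A B : 'M[R]_(m, n)) (P : 'M[R]_m).

Lemma frob_dot_semi_inner : semi_inner (@frob_dot R m n).
Proof.
split => [A B|A B C|a A B|A].
- by rewrite !frob_dotE; do 2!(apply: eq_bigr => ? _); rewrite mulrC.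
- by rewrite /frob_dot mulmxDl linearD.
- by rewrite /frob_dot -scalemxAl linearZ.
- by rewrite frob_dotE; do 2!(apply: sumr_ge0 => ? _); rewrite -expr2 sqr_ge0.
Qed.

Lemma frob_dot_mulmxl P A B : frob_dot (P *m A) B = frob_dot A (P^T *m B).
Proof. by rewrite /frob_dot trmx_mul trmxK -mulmxA mxtrace_mulC -mulmxA. Qed.

Lemma ler_entry_frob_norm A i j : `|A i j| <= frob_norm A.
Proof.
rewrite -sqrtr_sqr /frob_norm frob_dotE ler_wsqrtr //.
rewrite (bigD1 i) //= (bigD1 j) //= -expr2 -addrA lerDl addr_ge0 //.
  by apply: sumr_ge0 => ? _; rewrite -expr2 sqr_ge0.
by do 2!(apply: sumr_ge0 => ? _); rewrite -expr2 sqr_ge0.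
Qed.

Lemma frob_dot_row A B : frob_dot A B = \sum_i frob_dot (row i A) (row i B).
Proof.
rewrite frob_dotE; apply: eq_bigr => i _; rewrite frob_dotE big_ord1.
by apply: eq_bigr => j _; rewrite !mxE.
Qed.

Definition wdot P A B : R := frob_dot A (P *m B).

(** Transfers semidefiniteness, which is stated on column vectors, to matrices with several
    columns. *)
Lemma wdot_col P A B :
  wdot P A B = \sum_j ((col j A)^T *m P *m col j B) 0 0.
Proof.
rewrite /wdot frob_dotE exchange_big; apply: eq_bigr => j _.
rewrite -mulmxA mxE; apply: eq_bigr => i _; rewrite !mxE; congr (_ * _).
by apply: eq_bigr => k _; rewrite !mxE.
Qed.

Lemma wdot_semi_inner P : possemidef P -> semi_inner (wdot P).
Proof.
have hf := frob_dot_semi_inner.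
move=> [Psym Pge0]; split => [A B|A B C|a A B|A].
- by rewrite /wdot (siC hf) frob_dot_mulmxl Psym.
- by rewrite /wdot siDl.
- by rewrite /wdot siZl.
- by rewrite wdot_col; apply: sumr_ge0.
Qed.

Lemma ler_wdot P : exists2 C, 0 <= C & forall A, wdot P A A <= C * frob_dot A A.
Proof.
exists (\sum_i \sum_k `|P i k|).
  by do 2!(apply: sumr_ge0 => ? _).
move=> A; rewrite /wdot frob_dotE.
have entry i k : \sum_j A i j * (P i k * A k j) <= `|P i k| * frob_dot A A.
  rewrite (le_trans (_ : _ <= \sum_j `|P i k| * ((A i j ^+ 2 + A k j ^+ 2) / 2))) //.
    apply: ler_sum => j _; apply: le_trans (ler_norm _) _.
    rewrite mulrCA normrM ler_wpM2l // ler_norml.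
    by have := sqr_ge0 (A i j - A k j); have := sqr_ge0 (A i j + A k j);
      rewrite sqrrD sqrrB; lra.
  rewrite -mulr_sumr ler_wpM2l // -mulr_suml big_split /= ler_pdivrMr //.
  have h l : \sum_j A l j ^+ 2 <= frob_dot A A.
    rewrite frob_dotE (bigD1 l) //= (eq_bigr (fun j => A l j * A l j)) //.
    by rewrite lerDl; do 2!(apply: sumr_ge0 => ? _); rewrite -expr2 sqr_ge0.
  by have := h i; have := h k; lra.
rewrite mulr_suml; apply: ler_sum => i _; rewrite mulr_suml.
apply: le_trans (ler_sum _ (fun k _ => entry i k)).
rewrite exchange_big /= ler_sum // => j _.
by rewrite mxE mulr_sumr.
Qed.

End Frobenius.

Lemma frob_norm_ge0 (R : realType) (m n : nat) (A : 'M[R]_(m, n)) :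
  0 <= frob_norm A.
Proof. exact: sqrtr_ge0. Qed.

Lemma sqr_frob_norm (R : realType) (m n : nat) (A : 'M[R]_(m, n)) :
  frob_norm A ^+ 2 = frob_dot A A.
Proof. exact: (sqr_seminorm (frob_dot_semi_inner R m n)). Qed.

Lemma ler_frob_normD (R : realType) (m n : nat) (A B : 'M[R]_(m, n)) :
  frob_norm (A + B) <= frob_norm A + frob_norm B.
Proof. exact: (ler_seminormD (frob_dot_semi_inner R m n)). Qed.

Definition frob_simp (R : realType) (m n : nat) :=
  let h := frob_dot_semi_inner R m n in
  (siDl h, siDr h, siNl h, siNr h, siZl h, siZr h).

(** * Convergence and compactness for matrix sequences *)

Section MatrixConvergence.
Variables (R : realType) (m n : nat).
Implicit Types (A B : nat -> 'M[R]_(m, n)) (a b : 'M[R]_(m, n)).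

Lemma cvg_mx_entry A a i j : A @ \oo --> a -> (fun k => A k i j) @ \oo --> a i j.
Proof. by move=> h; exact: (cvg_comp A _ h (@coord_continuous _ _ _ i j a)). Qed.

Lemma frob_norm_cvg0 A a :
  (fun k => frob_norm (A k - a)) @ \oo --> (0 : R) -> A @ \oo --> a.
Proof.
move=> h; apply/cvgrPdist_lt => e e0; near=> k.
have : frob_norm (A k - a) < e by near: k; exact: (cvgr_lt (0 : R)).
move=> hk; rewrite -[`|_|]/(mx_norm _) mx_normrE; apply/bigmax_ltP; split => //.
move=> ij _; apply: le_lt_trans hk.
by rewrite !mxE distrC; have := ler_entry_frob_norm (A k - a) ij.1 ij.2; rewrite !mxE.
Unshelve. all: by end_near. Qed.

Lemma cvg_frob_norm_bound A a C (u : nat -> R) :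
  (forall k, frob_norm (A k - a) <= C * u k) -> u @ \oo --> (0 : R) ->
  A @ \oo --> a.
Proof.
move=> h hu; apply: frob_norm_cvg0.
apply: (@squeeze_cvgr _ _ _ _ (fun=> 0) (fun k => C * u k)).
- by apply: nearW => k; rewrite frob_norm_ge0 h.
- exact: cvg_cst.
- by rewrite -(mulr0 C); apply: cvgM => //; exact: cvg_cst.
Qed.

Lemma cvg_mxP A a :
  (forall i j, (fun k => A k i j) @ \oo --> a i j) -> A @ \oo --> a.
Proof.
move=> h; apply: frob_norm_cvg0; rewrite -(@sqrtr0 R).
suff h0 : (fun k => frob_dot (A k - a) (A k - a)) @ \oo --> (0 : R).
  exact: (cvg_comp _ _ h0 (@sqrt_continuous R 0)).
have hAa i j : (fun k => (A k - a) i j) @ \oo --> (0 : R).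
  rewrite -(subrr (a i j)) [X in X @ _ --> _](_ : _ = fun k => A k i j - a i j).
    by apply: cvgB => //; exact: cvg_cst.
  by apply/funext => k; rewrite !mxE.
rewrite [X in X @ _ --> _](_ : _ =
    fun k => \sum_i \sum_j (A k - a) i j * (A k - a) i j); last first.
  by apply/funext => k; rewrite frob_dotE.
rewrite [X in _ --> X](_ : _ = \sum_(i < m) \sum_(j < n) (0 : R) * 0); last first.
  by rewrite big1 // => i _; rewrite big1 // => j _; rewrite mulr0.
apply: cvg_big => [|i _]; first exact: add_continuous.
apply: cvg_big => [|j _]; first exact: add_continuous.
exact: cvgM.
Qed.

Lemma cvg_frob_dot A B a b : A @ \oo --> a -> B @ \oo --> b ->
  (fun k => frob_dot (A k) (B k)) @ \oo --> frob_dot a b.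
Proof.
move=> hA hB; rewrite frob_dotE.
rewrite [X in X @ _ --> _](_ : _ =
    fun k => \sum_i \sum_j A k i j * B k i j); last first.
  by apply/funext => k; rewrite frob_dotE.
apply: cvg_big => [|i _]; first exact: add_continuous.
apply: cvg_big => [|j _]; first exact: add_continuous.
by apply: cvgM; exact: cvg_mx_entry.
Qed.

Lemma cvg_frob_norm A a : A @ \oo --> a ->
  (fun k => frob_norm (A k - a)) @ \oo --> (0 : R).
Proof.
move=> hA; have hAa : (fun k => A k - a) @ \oo --> (0 : 'M[R]_(m, n)).
  by rewrite -(subrr a); apply: cvgB => //; exact: cvg_cst.
have := cvg_frob_dot hAa hAa.
rewrite {2}/frob_dot mul0mx linear0 => h.
rewrite -[X in _ --> X](@sqrtr0 R); exact: (cvg_comp _ _ h (@sqrt_continuous R 0)).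
Qed.

Lemma cvg_subseq (T : topologicalType) (u : nat -> T) (l : T) (f : nat -> nat) :
  (forall k, (k <= f k)%N) -> u @ \oo --> l -> (fun k => u (f k)) @ \oo --> l.
Proof.
move=> hf; apply: cvg_comp => U [K _ hK].
by exists K => // k /= hk; apply: hK => /=; apply: leq_trans hk (hf k).
Qed.

End MatrixConvergence.

Lemma cvg_mulmxl (R : realType) (p m n : nat) (P : 'M[R]_(p, m))
    (A : nat -> 'M[R]_(m, n)) a :
  A @ \oo --> a -> (fun k => P *m A k) @ \oo --> P *m a.
Proof.
move=> hA; apply: cvg_mxP => i j; rewrite mxE.
rewrite [X in X @ _ --> _](_ : _ = fun k => \sum_l P i l * A k l j).
  apply: cvg_big => [|l _]; first exact: add_continuous.
  by apply: cvgM; [exact: cvg_cst|exact: cvg_mx_entry].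
by apply/funext => k; rewrite mxE.
Qed.

Lemma cvg_row (R : realType) (m n : nat) (A : nat -> 'M[R]_(m, n))
    (a : 'M[R]_(m, n)) i :
  A @ \oo --> a -> (fun k => row i (A k)) @ \oo --> row i a.
Proof.
move=> hA; apply: cvg_mxP => i' j; rewrite mxE.
rewrite [X in X @ _ --> _](_ : _ = fun k => A k i j); first exact: cvg_mx_entry.
by apply/funext => k; rewrite mxE.
Qed.

(* [f] need not be increasing: limits pass along it as soon as [k <= f k]. *)
Lemma BolzanoWeierstrass_mx (R : realType) (m n : nat) (A : nat -> 'M[R]_(m, n)) C :
  (forall k, frob_norm (A k) <= C) ->
  exists2 f : nat -> nat, (forall k, (k <= f k)%N) &
    exists a : 'M[R]_(m, n), (fun k => A (f k)) @ \oo --> a.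
Proof.
move=> hA.
pose K : set 'rV[R]_(m * n) := [set v | forall j, `[- C, C]%classic (v ord0 j)].
have cK : compact K.
  apply: (@rV_compact R _ (fun=> `[- C, C]%classic)) => _.
  exact: segment_compact.
pose u k := mxvec (A k).
have uK k : K (u k).
  move=> j; case/mxvec_indexP: j => i j.
  rewrite /= in_itv /= mxvecE -ler_norml.
  exact: le_trans (ler_entry_frob_norm _ _ _) (hA k).
have [v [Kv clv]] := cK (u @ \oo) _ (filterE _ uK).
have near_v e k : 0 < e -> exists2 l, (k <= l)%N & `|v - u l| < e.
  move=> e0; have hk : (u @ \oo) (u @` [set l | (k <= l)%N]).
    by exists k => // l /= kl; exists l.
  have [_ [[l kl <-] hl]] := clv _ _ hk (nbhsx_ballx v e e0).
  by exists l => //; move: hl; rewrite mx_norm_ball.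
have /choice [f hf] k : exists l, (k <= l)%N /\ `|v - u l| < harmonic k.
  by have [l] := near_v _ k (harmonic_gt0 k); exists l.
exists f; first by move=> k; have [] := hf k.
exists (vec_mx v); apply/cvgrPdist_lt => e e0; near=> k.
have hk : `|v - u (f k)| < e.
  have [_ h] := hf k; apply: lt_trans h _; near: k.
  exact: (cvgr_lt (0 : R) (@cvg_harmonic R)).
apply: le_lt_trans hk.
rewrite -[leLHS]/(mx_norm _) mx_normrE; apply/bigmax_leP; split => // -[i j] _ /=.
rewrite -[leRHS]/(mx_norm _) mx_normrE.
apply: le_trans (le_bigmax _ _ (ord0, mxvec_index i j)) => /=.
by rewrite !mxE /= mxvecE.
Unshelve. all: by end_near. Qed.

Lemma cvg_ge0 (R : realType) (u : nat -> R) l :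
  (forall k, 0 <= u k) -> u @ \oo --> l -> 0 <= l.
Proof.
by move=> u0 ul; apply: (ler_cvg_to (cvg_cst (0 : R)) ul); exact: nearW.
Qed.

(** * Minty's theorem *)

Section Minty.
Variables (R : realType) (m n : nat).
Implicit Types (a b x : 'M[R]_(m, n)) (G : 'M[R]_(m, n) -> set 'M[R]_(m, n)).
Let hf := frob_dot_semi_inner R m n.

(** The convex hull of the triples [(a, b, <a, b>)] over the graph of [G], generated by binary
    combinations so that proofs go by induction. Its lower boundary in [s] is a convex function
    whose conjugate is, up to a swap of arguments, the Fitzpatrick function of [G]. *)
Inductive pairing_hull G : 'M[R]_(m, n) -> 'M[R]_(m, n) -> R -> Prop :=
| pairing_hull_gen a b : G a b -> pairing_hull G a b (frob_dot a b)
| pairing_hull_conv t a b s a' b' s' : 0 <= t <= 1 ->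
    pairing_hull G a b s -> pairing_hull G a' b' s' ->
    pairing_hull G (t *: a + (1 - t) *: a') (t *: b + (1 - t) *: b')
      (t * s + (1 - t) * s').

Definition monotone_rel G :=
  forall a b a' b', G a b -> G a' b' -> 0 <= frob_dot (a - a') (b - b').

(** The expression is affine in each triple separately, so a double induction reduces it to
    generators, where it is [<a - a', b - b'>]. Taking both triples equal bounds [<a, b>] by [s]. *)
Lemma pairing_hull_cross G a b s a' b' s' : monotone_rel G ->
  pairing_hull G a b s -> pairing_hull G a' b' s' ->
  0 <= s + s' - frob_dot a b' - frob_dot a' b.
Proof.
move=> mG; elim=> {a b s} [a b Gab|t a b s c d r /andP[t0 t1] _ IHa _ IHc] h.
  elim: h => {a' b' s'} [a' b' Gab'|t c d r c' d' r' /andP[t0 t1] _ IHc _ IHc'].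
    have := mG _ _ _ _ Gab Gab'; rewrite !frob_simp; lra.
  rewrite !frob_simp.
  have h0 : 0 <= 1 - t by lra.
  have := addr_ge0 (mulr_ge0 t0 IHc) (mulr_ge0 h0 IHc'); lra.
rewrite !frob_simp; have h0 : 0 <= 1 - t by lra.
have := addr_ge0 (mulr_ge0 t0 (IHa h)) (mulr_ge0 h0 (IHc h)); lra.
Qed.

Lemma pairing_hull_ge G a b s :
  monotone_rel G -> pairing_hull G a b s -> frob_dot a b <= s.
Proof. by move=> mG h; have := pairing_hull_cross mG h h; lra. Qed.

(* [x] is the limit of the half-differences [(a - b) / 2] along a sequence of
   the hull that minimises [|(a - b) / 2|^2 + s]; this infimum is nonnegative
   because [s] dominates [<a, b>], and the claim is the first-order optimality
   condition. *)
Lemma monotone_rel_extension G : monotone_rel G ->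
  exists x, forall a b, G a b -> 0 <= frob_dot (b + x) (a - x).
Proof.
move=> mG.
have [[a0 [b0 G0]]|nG] := pselect (exists a b, G a b); last first.
  by exists 0 => a b Gab; exfalso; apply: nG; exists a, b.
pose hd a b := 2^-1 *: (a - b).
pose psi a b (s : R) := frob_dot (hd a b) (hd a b) + s.
(* Since [<a, b> <= s], [psi a b s] is at least [|(a + b) / 2|^2]. *)
have psi_ge0 a b s : pairing_hull G a b s -> 0 <= psi a b s.
  move=> h; have := pairing_hull_ge mG h; have := si_ge0 hf (a + b).
  by rewrite /psi /hd !frob_simp (siC hf b a); lra.
pose V := [set v | exists a b s, pairing_hull G a b s /\ v = psi a b s].
have hV : has_inf V.
  split; first by exists (psi a0 b0 (frob_dot a0 b0)), a0, b0, (frob_dot a0 b0);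
    split => //; exact: pairing_hull_gen.
  by exists 0 => _ [a [b [s [h ->]]]]; exact: psi_ge0.
have inf_le a b s : pairing_hull G a b s -> inf V <= psi a b s.
  by move=> h; apply: (ge_inf hV.2); exists a, b, s.
have inf0 : 0 <= inf V.
  by apply: lb_le_inf => [|_ [a [b [s [h ->]]]]]; [exact: hV.1|exact: psi_ge0].
pose h k : R := harmonic k.
have h_gt0 k : 0 < h k by exact: harmonic_gt0.
have h_le1 k : h k <= 1 by rewrite /h /harmonic /= invf_le1 ?ler1n ?ltr0n.
(* The tolerance is squared because [opt] divides it by [h k]. *)
have /choice [p hp] k : exists p : 'M[R]_(m, n) * 'M[R]_(m, n) * R,
    pairing_hull G p.1.1 p.1.2 p.2 /\ psi p.1.1 p.1.2 p.2 < inf V + h k ^+ 2.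
  have [v [a [b [s [hh ->]]]] hv] := inf_adherent (exprn_gt0 2 (h_gt0 k)) hV.
  by exists (a, b, s).
pose X k := hd (p k).1.1 (p k).1.2.
have hd_conv t a b a' b' : hd (t *: a + (1 - t) *: a') (t *: b + (1 - t) *: b')
    = t *: hd a b + (1 - t) *: hd a' b'.
  rewrite /hd !scalerA ![t * _]mulrC ![(1 - t) * _]mulrC -!scalerA -scalerDr.
  by congr (_ *: _); rewrite !scalerBr opprD addrACA.
(* By the parallelogram law, [psi] at the midpoint of two triples is the mean of its values minus
   [|X k - X 0|^2 / 4]. It is at least [inf V], while the mean exceeds [inf V] by at most 1. *)
have X_bounded k : frob_norm (X k) <= frob_norm (X 0%N) + 2.
  have half : 0 <= (2^-1 : R) <= 1 by lra.
  have := inf_le _ _ _ (pairing_hull_conv half (hp k).1 (hp 0%N).1).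
  have := (hp k).2; have := (hp 0%N).2.
  rewrite /psi hd_conv -!/(X k) -!/(X 0%N).
  have hk : h k ^+ 2 <= 1 by rewrite expr_le1 // ltW.
  have hk0 : h 0%N ^+ 2 <= 1 by rewrite expr_le1 // ltW.
  move: (X k) (X 0%N) => xk x0 h1 h2 h3.
  have hd2 : frob_norm (xk - x0) <= 2.
    rewrite -(@ler_pXn2r _ 2) ?nnegrE ?frob_norm_ge0 // sqr_frob_norm.
    by move: h1 h2 h3; rewrite !frob_simp (siC hf xk x0); lra.
  have := ler_frob_normD (xk - x0) x0; rewrite subrK; lra.
have [f fge [x Xx]] := BolzanoWeierstrass_mx X_bounded.
exists x => a b Gab.
pose q := hd a b; pose s := frob_dot a b.
(* Move from the near-minimiser towards [(a, b, s)] with weight [h k], compare with [inf V] and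
   divide by [h k]. The third component of [p k] is eliminated through [0 <= inf V <= psi]. *)
have opt k : 0 <= h k * (1 + frob_dot (q - X k) (q - X k))
    + 2 * frob_dot (X k) q - frob_dot (X k) (X k) + s.
  have hk01 : 0 <= h k <= 1 by rewrite ltW //= h_le1.
  have := inf_le _ _ _ (pairing_hull_conv hk01 (pairing_hull_gen Gab) (hp k).1).
  have := inf_le _ _ _ (hp k).1; have := (hp k).2.
  rewrite /psi hd_conv -!/(X k) -/q -/s.
  move: (X k) (q) (s) (p k).2 (h k) (h_gt0 k) => xk q' s' sk hk hk0.
  rewrite !frob_simp (siC hf q' xk) => h1 h2 h3.
  rewrite -(pmulr_rge0 _ hk0); nra.
have : 0 <= 0 * (1 + frob_dot (q - x) (q - x))
    + 2 * frob_dot x q - frob_dot x x + s.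
  have cvh : (fun k => h (f k)) @ \oo --> (0 : R).
    exact: cvg_subseq fge (@cvg_harmonic R).
  apply: (cvg_ge0 (fun k => opt (f k))).
  apply: cvgD; last exact: cvg_cst.
  apply: cvgB; last exact: cvg_frob_dot.
  apply: cvgD; apply: cvgM.
  - exact: cvh.
  - apply: cvgD; first exact: cvg_cst.
    by apply: cvg_frob_dot; apply: cvgB => //; exact: cvg_cst.
  - exact: cvg_cst.
  - by apply: cvg_frob_dot => //; exact: cvg_cst.
rewrite /q /hd /s !frob_simp (siC hf b a) (siC hf b x); lra.
Qed.

End Minty.

(** Adjoining the single pair [(x, v)] to the graph keeps it monotone, so maximality says it was
    already there. *)
Lemma maximal_monotoneP (R : realType) (n : nat)
    (T : 'rV[R]_n -> set 'rV[R]_n) (x v : 'rV[R]_n) :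
  maximal_monotone T ->
  (forall a b, T a b -> 0 <= frob_dot (x - a) (v - b)) -> T x v.
Proof.
move=> [mT maxT] h.
pose T' a := [set b | T a b \/ (a = x /\ b = v)].
have hf := frob_dot_semi_inner R 1 n.
rewrite -(maxT T') => [|a b c d|y w Tw]; [by right| |by left].
move=> [Tac|[-> ->]] [Tbd|[-> ->]]; first exact: mT.
- by rewrite -[a - x]opprB -[c - v]opprB siNl // siNr // opprK; exact: h.
- exact: h.
- by rewrite !subrr; exact: (si_ge0 hf).
Qed.

(** The extension lemma for the monotone relation [a |-> alpha T (a + y)] yields [x] such that
    [(x + y, - x / alpha)] is monotonically related to all of [T]. By maximality it lies in the
    graph, and [x + y] is the resolvent point. *)
Lemma minty (R : realType) (n : nat) (T : 'rV[R]_n -> set 'rV[R]_n)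
    (alpha : R) (y : 'rV[R]_n) :
  0 < alpha -> maximal_monotone T -> resolvent alpha T y !=set0.
Proof.
move=> a0 mT.
pose G a := [set b | exists2 c, T (a + y) c & b = alpha *: c].
have hf := frob_dot_semi_inner R 1 n.
have [|x hx] := @monotone_rel_extension R 1 n G.
  move=> a b a' b' [c Tc ->] [c' Tc' ->].
  rewrite -scalerBr siZr // mulr_ge0 ?(ltW a0) //.
  have -> : a - a' = a + y - (a' + y) by rewrite opprD addrACA subrr addr0.
  exact: mT.1.
exists (x + y); exists (- alpha^-1 *: x); last first.
  by rewrite scalerA mulrN divff ?gt_eqF // scaleN1r addrC addrA addNr add0r.
apply: maximal_monotoneP => // a b Tab.
have /hx : G (a - y) (alpha *: b) by exists b; rewrite // subrK.
have ai : 0 < alpha^-1 by rewrite invr_gt0.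
move=> h; have := mulr_ge0 (ltW ai) h; rewrite -siZl // scalerDr scalerA.
rewrite mulVf ?gt_eqF // scale1r.
have -> : x + y - a = - (a - y - x) by rewrite !opprB addrA addrC addrCA addrA.
have -> : - alpha^-1 *: x - b = - (b + alpha^-1 *: x).
  by rewrite opprD scaleNr addrC.
by rewrite siNl // siNr // opprK siC.
Qed.

(** * Comparing weighted seminorms with the Frobenius norm *)

Section WeightedNorms.
Variables (R : realType) (m n : nat).
Implicit Types (P : 'M[R]_m) (A : 'M[R]_(m, n)).
Let hf := frob_dot_semi_inner R m n.

Lemma ler_of_sqr_le (a b : R) : 0 <= a -> 0 <= b -> a ^+ 2 <= a * b -> a <= b.
Proof.
move=> a0 b0; rewrite le_eqVlt in a0; case/predU1P: a0 => [<- //|a0].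
by rewrite expr2 ler_pM2l.
Qed.

Lemma ler_sqrtM (a b c : R) : 0 <= b -> 0 <= c -> a <= b * c ->
  Num.sqrt a <= Num.sqrt b * Num.sqrt c.
Proof. by move=> b0 c0 h; rewrite -sqrtrM // ler_wsqrtr. Qed.

Lemma ler_wseminorm P :
  exists2 C, 0 <= C & forall A, seminorm (wdot P) A <= C * frob_norm A.
Proof.
have [C C0 hC] := ler_wdot n P; exists (Num.sqrt C); first exact: sqrtr_ge0.
by move=> A; apply: ler_sqrtM => //; exact: si_ge0.
Qed.

(** Cauchy-Schwarz gives [|P A|^2 = <P A, A>_P <= |P A|_P |A|_P]; bound [|P A|_P] by [C |P A|] and
    cancel. A degenerate seminorm thus still controls [P A]. *)
Lemma ler_frob_norm_mulmx P : possemidef P ->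
  exists2 C, 0 <= C & forall A, frob_norm (P *m A) <= C * seminorm (wdot P) A.
Proof.
move=> hP; have [C C0 hC] := ler_wseminorm P; exists C => // A.
have hw := wdot_semi_inner n hP.
apply: ler_of_sqr_le; rewrite ?mulr_ge0 ?frob_norm_ge0 ?seminorm_ge0 //.
rewrite sqr_frob_norm mulrA [_ * C]mulrC.
apply: le_trans (ler_dot_seminorm hw (P *m A) A) _.
by rewrite ler_wpM2r ?seminorm_ge0.
Qed.

Lemma posdef_semidef P : posdef P -> possemidef P.
Proof.
move=> [Psym Pgt0]; split => // x.
by have [->|/Pgt0/ltW//] := eqVneq x 0; rewrite mulmx0 mxE.
Qed.

Lemma posdef_unit P : posdef P -> P \in unitmx.
Proof.
move=> [Psym Pgt0]; rewrite -row_free_unit -kermx_eq0; apply/rowV0P => v.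
move/sub_kermxP => vP; apply/eqP/negPn/negP => v0.
have /Pgt0 : v^T != 0 by rewrite -(trmx0 R) (inj_eq trmx_inj).
by rewrite trmxK vP mul0mx mxE ltxx.
Qed.

(** Same scheme, from [|A|^2 = <A, P^-1 A>_P]. *)
Lemma ler_frob_norm_posdef P : posdef P ->
  exists2 C, 0 <= C & forall A, frob_norm A <= C * seminorm (wdot P) A.
Proof.
move=> hP; have Pu := posdef_unit hP.
have hw := wdot_semi_inner n (posdef_semidef hP).
have [C C0 hC] := ler_wseminorm (invmx P); exists C => // A.
apply: ler_of_sqr_le; rewrite ?mulr_ge0 ?frob_norm_ge0 ?seminorm_ge0 //.
have h1 : frob_dot A A <= seminorm (wdot P) A * seminorm (wdot P) (invmx P *m A).
  by apply: le_trans (ler_dot_seminorm hw _ _); rewrite /wdot mulKVmx.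
rewrite sqr_frob_norm (le_trans h1) // mulrA [_ * C]mulrC [leRHS]mulrC.
rewrite ler_wpM2l ?seminorm_ge0 //.
have -> : seminorm (wdot P) (invmx P *m A) = seminorm (wdot (invmx P)) A.
  by rewrite /seminorm /wdot mulKVmx // (siC hf).
exact: hC.
Qed.

(* [P = P P^- P] for the generalised inverse [P^-] of [P]. *)
Lemma ler_wseminorm_mulmx P : possemidef P ->
  exists2 C, 0 <= C & forall A, seminorm (wdot P) A <= C * frob_norm (P *m A).
Proof.
move=> [Psym _]; have [C C0 hC] := ler_wseminorm (pinvmx P).
exists C => // A; apply: le_trans (hC _).
rewrite /seminorm ler_wsqrtr // /wdot.
have {1}<- : P *m pinvmx P *m P = P by rewrite mulmxKpV.
by rewrite -!mulmxA frob_dot_mulmxl Psym.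
Qed.

End WeightedNorms.

(** * Consensus matrices and their orthogonal complement *)

Section Consensus.
Variables (R : realType) (N n : nat) (P : 'M[R]_N).
Hypotheses (Psym : P^T = P) (Pnull : nullsp P = span_ones).

Lemma mul_ones0 : P *m ones = 0.
Proof.
by have : span_ones (ones : 'cV[R]_N); [exists 1; rewrite ?scale1r|rewrite -Pnull].
Qed.

Lemma null_consensus (Z : 'M[R]_(N, n)) : P *m Z = 0 ->
  exists z : 'rV[R]_n, Z = ones *m z.
Proof.
move=> PZ; have /choice [c hc] j : exists c, col j Z = c *: ones.
  have : nullsp P (col j Z) by rewrite /nullsp /= colE mulmxA PZ mul0mx.
  by rewrite Pnull => -[c _ <-]; exists c.
exists (\row_j c j); apply/matrixP => i j; rewrite !mxE big_ord1 !mxE mul1r.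
by have /matrixP/(_ i 0) := hc j; rewrite !mxE mulr1.
Qed.

(** The range of a symmetric matrix is the orthogonal complement of its null space. Concretely,
    [Y^T] lies in the row space of [P] because it kills [cokermx P], whose columns are multiples of
    [ones]. *)
Lemma range_orthogonal_ones (Y : 'M[R]_(N, n)) :
  ones^T *m Y = 0 -> exists S, Y = P *m S.
Proof.
move=> Y0; have YT0 : Y^T *m ones = 0.
  by rewrite -(trmxK Y^T) -[ones]trmxK -trmx_mul trmxK Y0 trmx0.
have : (Y^T <= P)%MS.
  rewrite submxE; apply/eqP/matrixP => i j.
  have : nullsp P (col j (cokermx P)).
    by rewrite /nullsp /= colE mulmxA mulmx_coker mul0mx.
  rewrite Pnull => -[c _ hc].
  have : col j (Y^T *m cokermx P) = 0.
    by rewrite colE -mulmxA -colE -hc -scalemxAr YT0 scaler0.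
  by move/matrixP => /(_ i 0); rewrite mxE => ->; rewrite !mxE.
move/submxP => [D hD]; exists D^T.
by rewrite -[Y]trmxK hD trmx_mul Psym.
Qed.

End Consensus.

(** * Summable perturbations and quasi-Fejer sequences *)

Lemma summable_series_cvg (R : realType) (u : nat -> R) :
  (forall k, 0 <= u k) -> (\sum_(0 <= k <oo) (u k)%:E < +oo)%E ->
  cvgn (series u).
Proof.
move=> u0 su; have uE0 k : (0 <= (u k)%:E)%E by rewrite lee_fin.
have sum_fin : (\sum_(0 <= k <oo) (u k)%:E)%E \is a fin_num.
  by rewrite ge0_fin_numE // nneseries_ge0.
apply: nondecreasing_is_cvgn; first exact: nondecreasing_series.
exists (fine (\sum_(0 <= k <oo) (u k)%:E)) => _ [k _ <-].
rewrite -lee_fin fineK // /series /= -sumEFin.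
by apply: nneseries_lim_ge => // i _ _; exact: uE0.
Qed.

Lemma quasi_Fejer_cvg (R : realType) (d e : nat -> R) :
  (forall k, 0 <= d k) -> (forall k, d k.+1 <= d k + e k) ->
  cvgn (series e) -> exists l : R, d @ \oo --> l.
Proof.
move=> d0 de se.
(* Subtracting the accumulated errors makes the sequence nonincreasing and bounded below. *)
pose u k := d k - series e k.
have [B hB] : exists B, forall k, series e k <= B.
  have [M [_ hM]] := cvg_seq_bounded se.
  exists (M + 1) => k; apply: le_trans (ler_norm _) _.
  by apply: hM => //; rewrite ltrDl.
have cu : cvgn u.
  apply: nonincreasing_is_cvgn.
    apply/nonincreasing_seqP => k; rewrite /u /series /= big_nat_recr //=.
    by have := de k; lra.
  by exists (- B) => _ [k _ <-]; have := hB k; have := d0 k; rewrite /u; lra.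
exists (limn u + limn (series e)).
rewrite [X in X @ _ --> _](_ : _ = fun k => u k + series e k).
  exact: cvgD.
by apply/funext => k; rewrite subrK.
Qed.

(** * The collective operator and the two stopping criteria *)

Section Collective.
Variables (R : realType) (n N : nat).
Variable (T : 'I_N.+1 -> 'rV[R]_n -> set 'rV[R]_n).
Hypothesis mT : forall i, maximal_monotone (T i).

Lemma collective_monotone Z V Z' V' :
  collective_op T Z V -> collective_op T Z' V' ->
  0 <= frob_dot (Z - Z') (V - V').
Proof.
move=> hV hV'; rewrite frob_dot_row; apply: sumr_ge0 => i _.
by rewrite !linearB /=; exact: (mT i).1.
Qed.

(** The inclusion decouples over the rows, so Minty's theorem applies to each [T i]; the default
    value in [prox] is therefore never reached. *)
Lemma proxP alpha Y : 0 < alpha ->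
  exists2 V, collective_op T (prox alpha (collective_op T) Y) V &
    Y = prox alpha (collective_op T) Y + alpha *: V.
Proof.
move=> a0; apply: (@xgetPex _ 0 (resolvent alpha (collective_op T) Y)).
have /choice [x hx] i : exists x, resolvent alpha (T i) (row i Y) x.
  exact: minty.
have /choice [v hv] i : exists v, T i (x i) v /\ row i Y = x i + alpha *: v.
  by have [v] := hx i; exists v.
exists (\matrix_i x i); exists (\matrix_i v i).
  by move=> i /=; rewrite !rowK; have [] := hv i.
by apply/row_matrixP => i; rewrite linearD /= linearZ /= !rowK; have [] := hv i.
Qed.

(** The monotonicity inequality against each fixed graph element passes to the limit, and maximality
    concludes. *)
Lemma collective_closed (Z V : nat -> 'M[R]_(N.+1, n)) Zl Vl :
  (forall k, collective_op T (Z k) (V k)) ->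
  Z @ \oo --> Zl -> V @ \oo --> Vl -> collective_op T Zl Vl.
Proof.
move=> hV cZ cV i; apply: maximal_monotoneP => // a b Tab.
apply: (@cvg_ge0 _ (fun k => frob_dot (row i (Z k) - a) (row i (V k) - b))).
  by move=> k; apply: (mT i).1 => //; exact: hV.
by apply: cvg_frob_dot; apply: cvgB; (exact: cvg_row || exact: cvg_cst).
Qed.

Lemma criterionA2_A1 (W Wt : 'M[R]_N.+1) alpha eps Z V : 0 < alpha ->
  criterionA2 T W Wt alpha eps Z V -> criterionA1 T W Wt alpha eps Z V.
Proof.
move=> a0 h2 k; have hf := frob_dot_semi_inner R N.+1 n.
set Zh := Zhat _ _ _ _ _ _; set Zt := prox _ _ _.
have [Vt TVt hZh] := proxP Zh a0; rewrite -/Zt in TVt hZh.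
apply/ler_addgt0Pr => d d0.
(* The slack [d] provides an actual element of [S_op] without the infimum having to be attained. *)
have : (frob_dist 0 (S_op alpha (collective_op T) Zh (Z k.+2))
    < (eps k.+1 / alpha + d / alpha)%:E)%E.
  by apply: le_lt_trans (h2 k) _; rewrite lte_fin ltrDl divr_gt0.
move=> /ereal_inf_lt [_ [B [U TU <-] <-]].
rewrite lte_fin sub0r -mulrDl ltr_pdivlMr // mulrC => hB; apply: ltW.
apply: le_lt_trans hB; set B' := U + _.
have -> : frob_norm (- B') = frob_norm B' by exact: (seminormN hf).
(* Pairing this with [Z k.+2 - Zt], where monotonicity makes the last term nonnegative, bounds the
   squared error by [alpha <Z k.+2 - Zt, B'>]. *)
have aB : alpha *: B' = Z k.+2 - Zt + alpha *: (U - Vt).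
  rewrite /B' scalerDr scalerA mulfV ?gt_eqF // scale1r hZh scalerBr.
  by rewrite opprD !addrA; congr (_ + _); rewrite -addrA addrC.
apply: ler_of_sqr_le; rewrite ?mulr_ge0 ?frob_norm_ge0 ?(ltW a0) //.
rewrite sqr_frob_norm mulrCA -ler_pdivrMl //.
apply: le_trans (ler_dot_seminorm hf _ _).
rewrite ler_pdivrMl // -siZr // aB [leRHS]siDr // lerDl siZr //.
by rewrite mulr_ge0 ?(ltW a0) // collective_monotone.
Qed.

End Collective.

(** * The product seminorm on pairs *)

Section PairNorm.
Variables (R : realType) (N n : nat) (P Q : 'M[R]_N).
Hypotheses (hP : possemidef P) (hQ : possemidef Q).

Definition pair_dot (X Y : 'M[R]_(N, n) * 'M[R]_(N, n)) : R :=
  wdot P X.1 Y.1 + wdot Q X.2 Y.2.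

Lemma pair_dot_semi_inner : semi_inner pair_dot.
Proof.
have wP := wdot_semi_inner n hP; have wQ := wdot_semi_inner n hQ.
split => [X Y|X Y Z|a X Y|X]; rewrite /pair_dot /=.
- by rewrite (siC wP) (siC wQ).
- by rewrite (siDl wP) (siDl wQ) addrACA.
- by rewrite (siZl wP) (siZl wQ) mulrDr.
- by rewrite addr_ge0 // si_ge0.
Qed.

Lemma ler_pair_seminorm1 X : seminorm (wdot P) X.1 <= seminorm pair_dot X.
Proof.
by rewrite ler_wsqrtr // lerDl; exact: (si_ge0 (wdot_semi_inner n hQ)).
Qed.

Lemma ler_pair_seminorm2 X : seminorm (wdot Q) X.2 <= seminorm pair_dot X.
Proof.
by rewrite ler_wsqrtr // lerDr; exact: (si_ge0 (wdot_semi_inner n hP)).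
Qed.

Lemma ler_pair_seminormD X :
  seminorm pair_dot X <= seminorm (wdot P) X.1 + seminorm (wdot Q) X.2.
Proof.
have wP := wdot_semi_inner n hP; have wQ := wdot_semi_inner n hQ.
have p0 := seminorm_ge0 (wdot P) X.1; have q0 := seminorm_ge0 (wdot Q) X.2.
rewrite -(@ler_pXn2r _ 2) ?nnegrE ?addr_ge0 ?seminorm_ge0 //.
rewrite (sqr_seminorm pair_dot_semi_inner) /pair_dot.
by rewrite -(sqr_seminorm wP) -(sqr_seminorm wQ) sqrrD; nra.
Qed.

End PairNorm.

(** * Telescoping the recursion *)

Definition cumul (R : realType) (N n : nat) (Z : nat -> 'M[R]_(N, n)) k :=
  \sum_(j < k.+1) Z j.

Lemma cumulS (R : realType) (N n : nat) (Z : nat -> 'M[R]_(N, n)) k :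
  cumul Z k.+1 = cumul Z k + Z k.+1.
Proof. by rewrite /cumul big_ord_recr. Qed.

(** As [alpha V] is the previous input of the proximal step minus [Z], each step adds
    [W Z^{k+2} - Wt Z^{k+1}] to that input. The first input [W Z^0] supplies the term of [M S]
    coming from [Z^0]. *)
Lemma Zhat_cumul (R : realType) (n N : nat) (W Wt : 'M[R]_N.+1) (alpha : R)
    (Z V : nat -> 'M[R]_(N.+1, n)) k : 0 < alpha ->
  correction_updates W Wt alpha Z V ->
  Zhat W Wt alpha Z V k = Wt *m Z k.+1 - (Wt - W) *m cumul Z k.+1.
Proof.
move=> a0 [V1 VS]; elim: k => [|k IH]; rewrite /Zhat.
  rewrite V1 scalerA mulfV ?gt_eqF // scale1r cumulS /cumul big_ord1.
  rewrite mulmxDl mul1mx mulmxDr !mulmxBl.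
  move: (W *m Z 1%N) (W *m Z 0%N) (Wt *m Z 1%N) (Wt *m Z 0%N) => a b c d.
  by apply/matrixP => i j; rewrite !mxE; ring.
rewrite VS scalerA mulfV ?gt_eqF // scale1r IH (cumulS _ k.+1).
rewrite mulmxDl mul1mx mulmxDr [(Wt - W) *m Z _]mulmxBl.
move: (W *m Z k.+2) (Wt *m Z k.+1) (Wt *m Z k.+2) (_ *m cumul _ _) => a b c d.
by apply/matrixP => i j; rewrite !mxE; ring.
Qed.

Lemma upper_gap_mulmx0 (R : realType) (m n : nat) (W Wt : 'M[R]_m)
    (A : 'M[R]_(m, n)) :
  W *m A = A -> Wt *m A = A -> (2^-1 *: (1%:M + W) - Wt) *m A = 0.
Proof.
move=> WA WtA; rewrite mulmxBl WtA -scalemxAl mulmxDl mul1mx WA.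
by apply/matrixP => i j; rewrite !mxE; field.
Qed.

(** * Fejer monotonicity and convergence of the inexact iteration *)

Section Fejer.
Variables (R : realType) (n N : nat) (W Wt : 'M[R]_N.+1) (alpha : R).
Variable (T : 'I_N.+1 -> 'rV[R]_n -> set 'rV[R]_n).
Hypotheses (mT : forall i, maximal_monotone (T i)) (a0 : 0 < alpha).
Variables M H : 'M[R]_N.+1.
Hypotheses (hM : M = Wt - W) (hH : H = 2^-1 *: (1%:M + W) - Wt).
Hypotheses (sWt : possemidef Wt) (sM : possemidef M) (sH : possemidef H).

(** A primal-dual certificate: when [M] is symmetric with null space spanned by [ones], [X.1] is
    consensual and the rows of [V] sum to 0, as [alpha V] lies in the range of [M]. *)
Definition optimal_pair (X : 'M[R]_(N.+1, n) * 'M[R]_(N.+1, n)) : Prop :=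
  exists V, [/\ collective_op T X.1 V, M *m X.1 = 0, H *m X.1 = 0
              & alpha *: V = - (M *m X.2)].

(** Expanding the squares, the claim becomes [<d, u>_Wt + <w, p>_M + |p|_M^2 <= 0]. Monotonicity
    gives this with the extra term [2 |d|_H^2] on the left, which is nonnegative. *)
Lemma prox_step_Fejer Z S p V Xs :
  collective_op T p V -> Wt *m Z - M *m S = p + alpha *: V ->
  optimal_pair Xs ->
  pair_dot Wt M ((p, S + p) - Xs) ((p, S + p) - Xs)
    + pair_dot Wt M ((p, S + p) - (Z, S)) ((p, S + p) - (Z, S))
  <= pair_dot Wt M ((Z, S) - Xs) ((Z, S) - Xs).
Proof.
move=> Tp hp [Vs [TVs MZs HZs aVs]]; case: Xs TVs MZs HZs aVs => Zs Ss /=.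
move=> TVs MZs HZs aVs.
have hf := frob_dot_semi_inner R N.+1 n.
have wWt := wdot_semi_inner n sWt; have wM := wdot_semi_inner n sM.
have wH := wdot_semi_inner n sH.
pose d := p - Zs; pose u := p - Z; pose w := S - Ss.
have Md : M *m d = M *m p by rewrite mulmxBr MZs subr0.
have Hd : H *m d = H *m p by rewrite mulmxBr HZs subr0.
(* The leftover [Wt p - p] is absorbed through [M + 2 H = 1 - Wt]. *)
have aV : alpha *: (V - Vs) = - (Wt *m u) - M *m w - M *m d - 2 *: (H *m d).
  have Hp : H *m p = 2^-1 *: (p + W *m p) - Wt *m p.
    by rewrite hH mulmxBl -scalemxAl mulmxDl mul1mx.
  have Mp : M *m p = Wt *m p - W *m p by rewrite hM mulmxBl.
  rewrite scalerBr aVs -[alpha *: V](addKr p) -hp Md Hd /u /w !mulmxBr Hp Mp.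
  move: (W *m p) (Wt *m p) (Wt *m Z) (M *m S) (M *m Ss) => a b c e f.
  by apply/matrixP => i j; rewrite !mxE; field.
have := mulr_ge0 (ltW a0) (collective_monotone mT Tp TVs).
rewrite -(siZr hf) aV -/d !(siDr hf) !(siNr hf) (siZr hf).
rewrite -!/(wdot Wt _ _) -!/(wdot M _ _) -!/(wdot H _ _).
have hdd := si_ge0 wH d.
have e1 : (p, S + p) - (Zs, Ss) = (d, w + p) by congr (_, _); rewrite /= addrAC.
have e2 : (p, S + p) - (Z, S) = (u, p) by congr (_, _); rewrite /= addrAC subrr add0r.
have e3 : (Z, S) - (Zs, Ss) = (d - u, w).
  by congr (_, _); rewrite /= /d /u [RHS]addrC opprB addrA subrK.
rewrite e1 e2 e3 /pair_dot /=.
have Mdx x : wdot M d x = wdot M p x.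
  by rewrite (siC wM) (siC wM p) /wdot Md.
clearbody d u w.
rewrite !Mdx (siC wM p d) Mdx.
rewrite !(siDl wM) !(siDr wM) !(siDl wWt) !(siDr wWt) !(siNl wWt) !(siNr wWt).
rewrite (siC wM w p) (siC wWt u d); lra.
Qed.

Variables (Z S p V : nat -> 'M[R]_(N.+1, n)) (e : nat -> R).
Hypotheses (hV : forall k, collective_op T (p k) (V k))
  (hstep : forall k, Wt *m Z k - M *m S k = p k + alpha *: V k)
  (hS : forall k, S k.+1 = S k + Z k.+1)
  (herr : forall k, frob_norm (Z k.+1 - p k) <= e k)
  (he : cvgn (series e)).

Let nrm := seminorm (pair_dot Wt M (n := n)).
Let X k := (Z k, S k).
Let Xt k := (p k, S k + p k).
Let wX := pair_dot_semi_inner n sWt sM.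

Lemma inexact_step_error :
  exists2 C, 0 <= C & forall k, nrm (X k.+1 - Xt k) <= C * e k.
Proof.
have [C1 C10 hC1] := ler_wseminorm n Wt; have [C2 C20 hC2] := ler_wseminorm n M.
exists (C1 + C2); first exact: addr_ge0.
move=> k; have -> : X k.+1 - Xt k = (Z k.+1 - p k, Z k.+1 - p k).
  by congr (_, _); rewrite /= hS opprD addrACA subrr add0r.
apply: le_trans (ler_pair_seminormD sWt sM _) _ => /=.
apply: le_trans (lerD (hC1 _) (hC2 _)) _.
by rewrite -mulrDl ler_wpM2l // addr_ge0.
Qed.

Lemma exact_step_Fejer Xs k : optimal_pair Xs ->
  nrm (Xt k - Xs) ^+ 2 + nrm (Xt k - X k) ^+ 2 <= nrm (X k - Xs) ^+ 2.
Proof.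
move=> oXs; rewrite !(sqr_seminorm wX).
exact: (prox_step_Fejer (hV k) (hstep k) oXs).
Qed.

Lemma exact_step_le Xs k : optimal_pair Xs -> nrm (Xt k - Xs) <= nrm (X k - Xs).
Proof.
move=> oXs; rewrite -(@ler_pXn2r _ 2) ?nnegrE ?seminorm_ge0 //.
have := exact_step_Fejer k oXs; have := sqr_ge0 (nrm (Xt k - X k)); lra.
Qed.

Lemma dist_optimal_cvg Xs : optimal_pair Xs ->
  exists l : R, (fun k => nrm (X k - Xs)) @ \oo --> l /\
    (fun k => nrm (Xt k - Xs)) @ \oo --> l.
Proof.
move=> oXs; have [C C0 hC] := inexact_step_error.
have tri k : nrm (X k.+1 - Xs) <= nrm (Xt k - Xs) + C * e k.
  have -> : X k.+1 - Xs = (Xt k - Xs) + (X k.+1 - Xt k).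
    by rewrite [RHS]addrC addrA subrK.
  by apply: le_trans (ler_seminormD wX _ _) _; rewrite lerD2l.
have sCe : cvgn (series (C *: e)) by exact: is_cvg_seriesZ.
have [l hl] : exists l : R, (fun k => nrm (X k - Xs)) @ \oo --> l.
  apply: (quasi_Fejer_cvg _ _ sCe) => k; first exact: seminorm_ge0.
  by apply: le_trans (tri k) _; rewrite lerD2r exact_step_le.
exists l; split => //.
(* The exact step lies between two consecutive inexact distances up to a vanishing error, so it has
   the same limit. *)
apply: (@squeeze_cvgr _ _ _ _ (fun k => nrm (X k.+1 - Xs) - C * e k)
  (fun k => nrm (X k - Xs))) => //.
  by apply: nearW => k; rewrite exact_step_le // andbT lerBlDr.
rewrite -[X in _ --> X]subr0; apply: cvgB.
  exact: (cvg_subseq (fun k => leqnSn k) hl).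
exact: (cvg_series_cvg_0 sCe).
Qed.

(** The squared increment is at most the drop in squared distance to [Xs], and both distances have
    the same limit. *)
Lemma increment_cvg0 Xs : optimal_pair Xs ->
  (fun k => nrm (Xt k - X k)) @ \oo --> (0 : R).
Proof.
move=> oXs; have [l [hl hlt]] := dist_optimal_cvg oXs.
pose u k := nrm (X k - Xs) ^+ 2 - nrm (Xt k - Xs) ^+ 2.
have cu : u @ \oo --> (0 : R).
  rewrite -(subrr (l ^+ 2)); apply: cvgB; rewrite expr2.
    rewrite [Y in Y @ _ --> _](_ : _ = fun k => nrm (X k - Xs) * nrm (X k - Xs)).
      exact: cvgM.
    by apply/funext => k; rewrite expr2.
  rewrite [Y in Y @ _ --> _](_ : _ = fun k => nrm (Xt k - Xs) * nrm (Xt k - Xs)).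
    exact: cvgM.
  by apply/funext => k; rewrite expr2.
have csu : (fun k => Num.sqrt (u k)) @ \oo --> (0 : R).
  by rewrite -(@sqrtr0 R); exact: (cvg_comp _ _ cu (@sqrt_continuous R 0)).
apply: (@squeeze_cvgr _ _ _ _ (fun=> 0) (fun k => Num.sqrt (u k))) => //.
  apply: nearW => k; rewrite seminorm_ge0 /=.
  rewrite -[leLHS]ger0_norm ?seminorm_ge0 // -sqrtr_sqr ler_wsqrtr // /u.
  by have := exact_step_Fejer k oXs; lra.
exact: cvg_cst.
Qed.

Lemma inexact_correction_cvg Xs : posdef Wt -> nullsp M = span_ones ->
  W *m ones = ones -> Wt *m ones = ones -> optimal_pair Xs ->
  exists Xl, [/\ optimal_pair Xl, Z @ \oo --> Xl.1 &
    (fun k => M *m S k) @ \oo --> M *m Xl.2].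
Proof.
move=> pWt Mnull W1 Wt1 oXs.
have Msym := sM.1.
have [c1 c10 hc1] := ler_frob_norm_posdef n pWt.
have [c2 c20 hc2] := ler_frob_norm_mulmx n sM.
have cZ (Y Xs' : 'M[R]_(N.+1, n) * 'M[R]_(N.+1, n)) :
      frob_norm (Y.1 - Xs'.1) <= c1 * nrm (Y - Xs').
  apply: le_trans (hc1 _) _; rewrite ler_wpM2l //.
  exact: (ler_pair_seminorm1 Wt sM (Y - Xs')).
have cS (Y Xs' : 'M[R]_(N.+1, n) * 'M[R]_(N.+1, n)) :
      frob_norm (M *m Y.2 - M *m Xs'.2) <= c2 * nrm (Y - Xs').
  rewrite -mulmxBr; apply: le_trans (hc2 _) _; rewrite ler_wpM2l //.
  exact: (ler_pair_seminorm2 M sWt (Y - Xs')).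
have inc := increment_cvg0 oXs.
have cvpZ : (fun k => p k - Z k) @ \oo --> (0 : 'M[R]_(N.+1, n)).
  by apply: (cvg_frob_norm_bound (C := c1) _ inc) => k; rewrite subr0; exact: (cZ (Xt k) (X k)).
(* The second component of [Xt k - X k] is [p k] itself: vanishing increments force asymptotic
   consensus. *)
have cvMp : (fun k => M *m p k) @ \oo --> (0 : 'M[R]_(N.+1, n)).
  apply: (cvg_frob_norm_bound (C := c2) _ inc) => k; rewrite subr0.
  by apply: le_trans (cS (Xt k) (X k)); rewrite /= mulmxDr addrC addKr.
have [B hB] : exists B, forall k, nrm (X k - Xs) <= B.
  have [l [hl _]] := dist_optimal_cvg oXs.
  have [L [_ hL]] := cvg_seq_bounded (cvgP _ hl).
  exists (L + 1) => k; apply: le_trans (ler_norm _) _.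
  by apply: hL => //; rewrite ltrDl.
have Zbd k : frob_norm (Z k) <= c1 * B + frob_norm Xs.1.
  have := ler_frob_normD (Z k - Xs.1) Xs.1; rewrite subrK.
  have := cZ (X k) Xs; have := ler_wpM2l c10 (hB k); rewrite /=; lra.
have Sbd k : frob_norm (M *m S k) <= c2 * B + frob_norm (M *m Xs.2).
  have := ler_frob_normD (M *m S k - M *m Xs.2) (M *m Xs.2); rewrite subrK.
  have := cS (X k) Xs; have := ler_wpM2l c20 (hB k); rewrite /=; lra.
(* Compactness is applied to [M S], the part of [S] that the seminorm controls. *)
have [f fge [Zl hZl]] := BolzanoWeierstrass_mx Zbd.
have [g gge [Q hQ]] := BolzanoWeierstrass_mx (fun k => Sbd (f k)).
pose h k := f (g k).
have hge k : (k <= h k)%N by exact: leq_trans (gge k) (fge _).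
have {}hZl : (fun k => Z (h k)) @ \oo --> Zl by exact: cvg_subseq gge hZl.
have hpl : (fun k => p (h k)) @ \oo --> Zl.
  rewrite [Y in Y @ _ --> _](_ : _ = fun k => p (h k) - Z (h k) + Z (h k)).
    by rewrite -[Zl]add0r; apply: cvgD => //; exact: (cvg_subseq hge cvpZ).
  by apply/funext => k; rewrite subrK.
have MZl : M *m Zl = 0.
  apply: (@cvg_unique _ (@norm_hausdorff _ 'M[R]_(N.+1, n)) _ _ _ _
    (cvg_mulmxl (P := M) hpl)).
  exact: (cvg_subseq hge cvMp).
have [z Zlz] := null_consensus Mnull MZl.
have WtZl : Wt *m Zl = Zl by rewrite Zlz mulmxA Wt1.
have HZl : H *m Zl = 0.
  by rewrite hH upper_gap_mulmx0 // Zlz mulmxA W1.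
(* Orthogonality to [ones] survives the limit and puts [Q] back in the range of [M], which yields
   [Sl]. *)
have Q1 : ones^T *m Q = 0.
  have h1 : (fun k => ones^T *m (M *m S (h k))) @ \oo --> ones^T *m Q.
    exact: cvg_mulmxl hQ.
  suff h0 : (fun k => ones^T *m (M *m S (h k))) @ \oo --> (0 : 'M[R]_(1, n)).
    exact: (cvg_unique (@norm_hausdorff _ 'M[R]_(1, n)) h1 h0).
  rewrite [Y in Y @ _ --> _](_ : _ = fun=> 0); first exact: cvg_cst.
  apply/funext => k; rewrite mulmxA -[ones^T *m M]trmxK trmx_mul trmxK Msym.
  by rewrite mul_ones0 // trmx0 mul0mx.
have [Sl QSl] := range_orthogonal_ones Msym Mnull Q1.
pose Vl := - (alpha^-1 *: Q).
have aVl : alpha *: Vl = - (M *m Sl).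
  by rewrite scalerN scalerA mulfV ?gt_eqF // scale1r QSl.
(* Solve [hstep] for [V] and pass to the limit, using [Wt Zl = Zl]; the factor [alpha^-1] is written
   as a scalar matrix so that [cvg_mulmxl] applies. *)
have hVl : (fun k => V (h k)) @ \oo --> Vl.
  have -> : Vl = alpha^-1%:M *m (Wt *m Zl - Q - Zl).
    by rewrite WtZl addrAC subrr add0r mul_scalar_mx scalerN.
  rewrite [Y in Y @ _ --> _](_ : _ = fun k =>
      alpha^-1%:M *m (Wt *m Z (h k) - M *m S (h k) - p (h k))); last first.
    apply/funext => k; rewrite hstep [p _ + _]addrC addrK mul_scalar_mx scalerA.
    by rewrite mulVf ?gt_eqF // scale1r.
  by apply: cvg_mulmxl; apply: cvgB => //; apply: cvgB => //; exact: cvg_mulmxl.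
have oXl : optimal_pair (Zl, Sl).
  exists Vl; split => //.
  exact: (collective_closed mT (fun k => hV (h k)) hpl hVl).
(* The distance to the cluster point converges, hence to its limit [0] along
   the subsequence. *)
have dist0 : (fun k => nrm (X k - (Zl, Sl))) @ \oo --> (0 : R).
  have [l [hl _]] := dist_optimal_cvg oXl.
  suff hl0 : (fun k => nrm (X (h k) - (Zl, Sl))) @ \oo --> (0 : R).
    have := cvg_subseq hge hl.
    by move/(cvg_unique (@norm_hausdorff _ R)) => /(_ _ hl0) <-.
  have [d1 d10 hd1] := ler_wseminorm n Wt.
  have [d2 d20 hd2] := ler_wseminorm_mulmx n sM.
  apply: (@squeeze_cvgr _ _ _ _ (fun=> 0) (fun k =>
    d1 * frob_norm (Z (h k) - Zl) + d2 * frob_norm (M *m S (h k) - M *m Sl))).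
  - apply: nearW => k; rewrite seminorm_ge0 /=.
    apply: le_trans (ler_pair_seminormD sWt sM _) _; apply: lerD; first exact: hd1.
    by rewrite -mulmxBr; exact: hd2.
  - exact: cvg_cst.
  - have -> : (0 : R) = d1 * 0 + d2 * 0 by rewrite !mulr0 addr0.
    apply: cvgD; apply: cvgM; try exact: cvg_cst; apply: cvg_frob_norm => //.
    by rewrite -QSl.
exists (Zl, Sl); split => //.
  by apply: (cvg_frob_norm_bound (C := c1) _ dist0) => k; exact: (cZ (X k)).
by apply: (cvg_frob_norm_bound (C := c2) _ dist0) => k; exact: (cS (X k)).
Qed.

End Fejer.

(** * From the abstract iteration back to the agents *)

Lemma sum_row_ones (R : realType) (m n : nat) (A : 'M[R]_(m, n)) :
  ones^T *m A = \sum_i row i A.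
Proof.
apply/rowP => j; rewrite mxE summxE; apply: eq_bigr => i _.
by rewrite !mxE mul1r.
Qed.

Theorem theorem4p3 (R : realType) (n N : nat) (e : rel 'I_N.+1)
  (T : 'I_N.+1 -> 'rV[R]_n -> set 'rV[R]_n) (W Wt : 'M[R]_N.+1) (alpha : R)
  (eps : nat -> R) (Z V : nat -> 'M[R]_(N.+1, n))
  (he : connected_undirected e)
  (hT : assumption1 T)
  (hW : assumption2 e W Wt)
  (halpha : 0 < alpha)
  (heps_ge0 : forall k, 0 <= eps k.+1)
  (heps_sum : (\sum_(0 <= k <oo) (eps k.+1)%:E < +oo)%E)
  (hZV : correction_updates W Wt alpha Z V)
  (hcrit : criterionA1 T W Wt alpha eps Z V \/ criterionA2 T W Wt alpha eps Z V) :
  exists zinf : 'rV[R]_n,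
    [/\ sum_op T zinf 0,
        forall i, (fun k => row i (Z k)) @ \oo --> zinf
      & forall i, exists2 vinf : 'rV[R]_n,
          T i zinf vinf & (fun k => row i (V k)) @ \oo --> vinf].
Proof.
case: hT => mT _ [zs [us Tus sum_us]].
case: hW => _ [W1 _ Wt1 _] Mnull _ pWt sH sM.
have sWt := posdef_semidef pWt.
have A1 : criterionA1 T W Wt alpha eps Z V.
  by case: hcrit => // A2; exact: criterionA2_A1.
pose Zh := Zhat W Wt alpha Z V.
pose p k := prox alpha (collective_op T) (Zh k).
have /choice [U hU] k : exists U, collective_op T (p k) U /\ Zh k = p k + alpha *: U.
  by have [U] := proxP mT (Zh k) halpha; exists U.
(* The selections [us] at the solution [zs] sum to 0, so [- alpha V0] is orthogonal to [ones] and
   has the form [M S0]. *)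
have [Xs oXs] : exists Xs, optimal_pair alpha T (Wt - W) (2^-1 *: (1%:M + W) - Wt) Xs.
  pose V0 : 'M[R]_(N.+1, n) := \matrix_i us i.
  have [S0 hS0] : exists S, - alpha *: V0 = (Wt - W) *m S.
    apply: (range_orthogonal_ones sM.1 Mnull).
    rewrite -scalemxAr sum_row_ones (eq_bigr us) ?sum_us ?scaler0 //.
    by move=> i _; rewrite rowK.
  exists (ones *m zs, S0), V0; split => /=.
  - move=> i; rewrite rowK; have -> : row i (ones *m zs) = zs; last exact: Tus.
    by apply/rowP => j; rewrite !mxE big_ord1 mxE mul1r.
  - by rewrite mulmxA mulmxBl Wt1 W1 subrr mul0mx.
  - by apply: upper_gap_mulmx0; rewrite mulmxA ?W1 ?Wt1.
  - by rewrite -hS0 scaleNr opprK.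
(* The iteration starts at [(Z^1, S^1)], since the error bounds begin with [Z^2]. *)
have [] := @inexact_correction_cvg R n N W Wt alpha T mT halpha _ _ erefl erefl
  sWt sM sH (fun k => Z k.+1) (fun k => cumul Z k.+1) p U (fun k => eps k.+1)
  _ _ _ A1 _ Xs pWt Mnull W1 Wt1 oXs.
- by move=> k; have [] := hU k.
- by move=> k; have [_ <-] := hU k; rewrite /Zh Zhat_cumul.
- by move=> k; rewrite cumulS.
- exact: summable_series_cvg.
move=> [Zl Sl] [[Vl [TVl MZl _ aVl]] cZ cS]; rewrite /= in TVl MZl aVl cZ cS.
have [z Zlz] := null_consensus Mnull MZl.
have rowZl i : row i Zl = z.
  by rewrite Zlz; apply/rowP => j; rewrite !mxE big_ord1 mxE mul1r.
(* [V] comes from the inexact iterates, unlike the exact selections [U], so its limit is read off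
   the update formula. *)
have cV : (fun k => V k.+2) @ \oo --> Vl.
  have -> : Vl = alpha^-1%:M *m (Wt *m Zl - (Wt - W) *m Sl - Zl).
    rewrite -aVl [in RHS]Zlz mulmxA Wt1 -Zlz addrAC subrr add0r mul_scalar_mx.
    by rewrite scalerA mulVf ?gt_eqF // scale1r.
  rewrite [Y in Y @ _ --> _](_ : _ = fun k => alpha^-1%:M *m
      (Wt *m Z k.+1 - (Wt - W) *m cumul Z k.+1 - Z k.+2)); last first.
    by apply/funext => k; rewrite hZV.2 Zhat_cumul // mul_scalar_mx.
  apply: cvg_mulmxl; apply: cvgB; last exact: (cvg_subseq (fun k => leqnSn k) cZ).
  by apply: cvgB => //; exact: cvg_mulmxl.
exists z; split.
- exists (fun i => row i Vl); first by move=> i; rewrite -(rowZl i); exact: TVl.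
  rewrite -sum_row_ones; apply: (scalerI (lt0r_neq0 halpha)).
  rewrite scaler0 scalemxAr aVl mulmxN mulmxA -[ones^T *m _]trmxK trmx_mul trmxK.
  by rewrite sM.1 mul_ones0 // trmx0 mul0mx oppr0.
- move=> i; rewrite -(rowZl i); apply: cvg_row.
  by rewrite -cvg_shiftS.
- move=> i; exists (row i Vl); first by rewrite -(rowZl i); exact: TVl.
  by apply: cvg_row; rewrite -cvg_shiftS -cvg_shiftS.
Qed.
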